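(* For all integers $N\ge 0$ and $n\ge 1$, $$E_{N,2n}=(2n)!\sum_{r=1}^n(-1)^r\sum_{\substack{i_1+\cdots+i_r=n\\ i_1,\dots,i_r\ge 1}}\frac{\bigl((2N)!\bigr)^r}{(2N+2i_1)!\cdots(2N+2i_r)!}.$$
   Context: For an integer $N\ge 0$, the hypergeometric Euler numbers $E_{N,n}$ ($n\ge 0$) are defined by $\dfrac{1}{F_N(t)}=\sum_{n=0}^\infty E_{N,n}\frac{t^n}{n!}$, where $F_N(t)={}_1F_2\bigl(1;N+1,\tfrac{2N+1}{2};\tfrac{t^2}{4}\bigr)=\sum_{m\ge 0}\frac{(2N)!}{(2N+2m)!}t^{2m}$ (equivalently $\sum_n E_{N,n}t^n/n!=\frac{t^{2N}/(2N)!}{\cosh t-\sum_{m=0}^{N-1}t^{2m}/(2m)!}$). The inner sum runs over ordered $r$-tuples of positive integers summing to $n$. *)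

(* Defs.v *)
From mathcomp Require Import all_boot all_order all_algebra.
From mathcomp Require Import ring.

Set Implicit Arguments.
Unset Strict Implicit.
Unset Printing Implicit Defensive.

Import Order.TTheory GRing.Theory Num.Theory.
Local Open Scope ring_scope.

(** A formal power series [\sum_n a_n t^n] over Q is its coefficient sequence;
    two series are equal when they agree pointwise ([=1]). *)
Definition fps : Type := nat -> rat.

Definition fps1 : fps := fun n => (n == 0%N)%:R.

Definition fps_mul (a b : fps) : fps :=
  fun n => \sum_(k < n.+1) a k * b (n - k)%N.

(** The multiplicative inverse, computed from [a * b = 1]; it is an inverse only
    when [a 0 != 0] (see [fps_mulV]).  [fps_inv_seq a n] lists the first [n.+1]
    coefficients. *)
Fixpoint fps_inv_seq (a : fps) (n : nat) : seq rat :=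
  if n is m.+1 then
    let s := fps_inv_seq a m in
    rcons s (- (a 0%N)^-1 * \sum_(k < m.+1) a k.+1 * s`_(m - k))
  else [:: (a 0%N)^-1].

Definition fps_inv (a : fps) : fps := fun n => (fps_inv_seq a n)`_n.

(** Substitution of the monomial [c t^2] for the variable. *)
Definition fps_subst_sq (c : rat) (a : fps) : fps :=
  fun n => if odd n then 0 else a n./2 * c ^+ n./2.

(** Pochhammer symbol (rising factorial) [(x)_m]. *)
Definition pochhammer (x : rat) (m : nat) : rat := \prod_(j < m) (x + j%:R).

(** Generalized hypergeometric series [pFq(as; bs; t)], as a formal series. *)
Definition hypergeometric (ups lows : seq rat) : fps :=
  fun m => \prod_(a <- ups) pochhammer a m
           / (\prod_(b <- lows) pochhammer b m * m`!%:R).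

(** [F_N(t) = 1F2(1; N+1, (2N+1)/2; t^2/4)]. *)
Definition euler_F (N : nat) : fps :=
  fps_subst_sq (1 / 4)
    (hypergeometric [:: 1] [:: N.+1%:R; (2 * N + 1)%:R / 2]).

(** [1 / F_N(t) = \sum_n E_{N,n} t^n / n!]. *)
Definition hypergeometric_euler (N n : nat) : rat :=
  n`!%:R * fps_inv (euler_F N) n.

(** Tuples of [r] positive integers with sum [n]; each part is at most [n], so
    ranging over ['I_n.+1] loses nothing. *)
Definition compositions (n r : nat) : {set {ffun 'I_r -> 'I_n.+1}} :=
  [set i : {ffun 'I_r -> 'I_n.+1} |
     [forall j, (0 < i j)%N] && (\sum_(j < r) i j == n)%N].

Lemma size_fps_inv_seq a n : size (fps_inv_seq a n) = n.+1.
Proof. by elim: n => //= n IHn; rewrite size_rcons IHn. Qed.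

Lemma nth_fps_inv_seq a n k : (k <= n)%N -> (fps_inv_seq a n)`_k = fps_inv a k.
Proof.
elim: n => [|n IHn]; first by rewrite leqn0 => /eqP->.
rewrite leq_eqVlt => /orP[/eqP-> //|]; rewrite ltnS => lekn.
by rewrite /= nth_rcons size_fps_inv_seq ltnS lekn IHn.
Qed.

Lemma fps_inv0 a : fps_inv a 0 = (a 0%N)^-1.
Proof. by []. Qed.

Lemma fps_invS a n :
  fps_inv a n.+1 = - (a 0%N)^-1 * \sum_(k < n.+1) a k.+1 * fps_inv a (n - k)%N.
Proof.
rewrite /fps_inv /= nth_rcons size_fps_inv_seq ltnn eqxx; congr (_ * _).
by apply: eq_bigr => k _; rewrite nth_fps_inv_seq ?leq_subr.
Qed.

Lemma fps_mulV a : a 0%N != 0 -> fps_mul a (fps_inv a) =1 fps1.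
Proof.
move=> a0 [|n]; rewrite /fps_mul /fps1.
  by rewrite big_ord1 fps_inv0 divff.
rewrite big_ord_recl subn0 fps_invS mulrA mulrN divff // mulN1r.
by apply/eqP; rewrite addrC subr_eq0; apply/eqP/eq_bigr.
Qed.

Lemma fps_inv_unique a b : a 0%N != 0 -> fps_mul a b =1 fps1 -> b =1 fps_inv a.
Proof.
move=> a0 ab n; elim/ltn_ind: n => n IHn.
have := etrans (ab n) (esym (fps_mulV a0 n)).
rewrite /fps_mul !big_ord_recl !subn0.
rewrite (eq_bigr (fun k : 'I_n => a (lift ord0 k) * fps_inv a (n - lift ord0 k)%N)).
  by move/addIr/(mulfI a0).
by move=> k _; rewrite IHn //= /bump leq0n; case: n k {IHn} => [[]|n k] //;
   rewrite add1n subSS ltnS leq_subr.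
Qed.

Lemma pochhammer1 m : pochhammer 1 m = m`!%:R.
Proof.
rewrite /pochhammer; elim: m => [|m IHm]; first by rewrite big_ord0.
by rewrite big_ord_recr /= IHm factS natrM mulrC -natr1 addrC.
Qed.

Lemma pochhammer_dbl N m :
  pochhammer N.+1%:R m * pochhammer ((2 * N + 1)%:R / 2) m * 4 ^+ m
    * (2 * N)`!%:R = (2 * N + 2 * m)`!%:R.
Proof.
rewrite /pochhammer; elim: m => [|m IHm].
  by rewrite !big_ord0 !mul1r addn0.
rewrite !big_ord_recr /= mulnS addnCA !add2n !factS !natrM -IHm exprS.
set A := \prod_(i < m) _; set B := \prod_(i < m) _.
have S k : k.+1%:R = k%:R + 1 :> rat by rewrite natr1.
rewrite !(S N, S (2 * N + 2 * m).+1, S (2 * N + 2 * m)%N, natrD, natrM).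
by field.
Qed.

Lemma euler_FE N n :
  euler_F N n = if odd n then 0 else (2 * N)`!%:R / (2 * N + n)`!%:R.
Proof.
rewrite /euler_F /fps_subst_sq; case: ifPn => // even_n.
have def_n : n = (2 * n./2)%N by rewrite mul2n even_halfK.
rewrite [in RHS]def_n; move: n./2 => m {n even_n def_n}.
rewrite /hypergeometric !big_cons !big_nil !mulr1 pochhammer1.
have nz k : k`!%:R != 0 :> rat by rewrite pnatr_eq0 -lt0n fact_gt0.
have := pochhammer_dbl N m; set x := pochhammer _ _; set y := pochhammer _ _.
move=> def; have := nz (2 * N + 2 * m)%N; rewrite -def.
rewrite !mulf_eq0 !negb_or => /andP[/andP[/andP[x0 y0] z0] f0].
by rewrite expr_div_n expr1n; field; rewrite ?x0 ?y0 ?z0 ?f0 ?nz.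
Qed.

Lemma hypergeometric_eulerP N :
  fps_mul (euler_F N) (fun n => hypergeometric_euler N n / n`!%:R) =1 fps1.
Proof.
have nz k : k`!%:R != 0 :> rat by rewrite pnatr_eq0 -lt0n fact_gt0.
move=> n; rewrite -(@fps_mulV (euler_F N)).
  by apply: eq_bigr => k _; rewrite /hypergeometric_euler mulrAC divff ?mul1r.
by rewrite euler_FE addn0 divff ?oner_eq0.
Qed.

(* Main.v *)
(** Put [s = t^2] and [1 + q(s) = F_N(t)], truncated at [s^n].  Modulo [s^(n+1)]
    the inverse of [1 + q] is the geometric sum of the [(-q)^r] for [r <= n], as
    [q] has no constant term, and the coefficient of [s^n] in [q^r] is the sum
    over the compositions of [n] into [r] parts. *)
Require Import Defs.
From mathcomp Require Import all_boot all_order all_algebra.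

Import Order.TTheory GRing.Theory Num.Theory.
Local Open Scope ring_scope.

(** The recursion for an inverse determines each coefficient from earlier ones, so an inverse valid
    only up to order [n], such as a truncated geometric sum, suffices. *)
Lemma fps_inv_unique_upto (a b : fps) (n : nat) : a 0%N != 0 ->
  (forall k, (k <= n)%N -> fps_mul a b k = fps1 k) -> b n = fps_inv a n.
Proof.
move=> a0; elim/ltn_ind: n => n IHn ab.
have := etrans (ab n (leqnn n)) (esym (fps_mulV a0 n)).
rewrite /fps_mul !big_ord_recl !subn0.
rewrite (eq_bigr (fun k : 'I_n =>
   a (lift ord0 k) * fps_inv a (n - lift ord0 k)%N)).
  by move/addIr/(mulfI a0).
move=> k _; have ltkn : (n - lift ord0 k < n)%N.
  by case: n k {IHn ab} => [[]|m k]; rewrite // subSS ltnS leq_subr.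
by rewrite IHn // => j lej; rewrite ab // (leq_trans lej) ?leq_subr.
Qed.

(** ['X] divides [p], hence ['X^r] divides [p ^+ r]. *)
Lemma coef_exp_lt (R : comNzRingType) (p : {poly R}) (k r : nat) :
  p`_0 = 0 -> (k < r)%N -> (p ^+ r)`_k = 0.
Proof.
move=> p0 ltkr; have -> : p = drop_poly 1 p * 'X.
  rewrite -[LHS](poly_take_drop 1) expr1 -[RHS]add0r; congr (_ + _).
  by apply/polyP=> -[|i]; rewrite coef_take_poly coef0 //= p0.
by rewrite exprMn coefMXn ltkr.
Qed.

Lemma coef_exp_compositions (R : comNzRingType) (p : {poly R}) (n r : nat) :
  p`_0 = 0 -> (size p <= n.+1)%N ->
  (p ^+ r)`_n = \sum_(i in compositions n r) \prod_(j < r) p`_(i j).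
Proof.
move=> p0 szp; have {1}-> : p = \sum_(i < n.+1) p`_i *: 'X^i.
  by rewrite -poly_def; apply/polyP=> i; rewrite coef_poly ltnS;
     case: leqP => // ltni; rewrite nth_default // (leq_trans szp).
(* As a product over ['I_r], the power distributes into a sum over all choices of one exponent per
   factor. *)
rewrite -[r in LHS]card_ord -prodr_const bigA_distr_bigA coef_sum /=.
rewrite [LHS](bigID (mem (compositions n r))) /= [X in _ + X]big1 ?addr0.
  apply: eq_bigr => f; rewrite inE => /andP[_ /eqP sum_f].
  by rewrite scaler_prod prodrXr sum_f coefZ coefXn eqxx mulr1.
move=> f; rewrite inE negb_and => nf; rewrite scaler_prod prodrXr coefZ coefXn.
case/orP: nf => [/forallPn[j]|/negPf]; last first.
  by rewrite eq_sym => ->; rewrite mulr0.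
by rewrite lt0n negbK => /eqP fj; rewrite (bigD1 j) //= fj p0 !mul0r.
Qed.

Theorem theorem1 (N n : nat) (hn : (1 <= n)%N) :
  hypergeometric_euler N (2 * n) =
    (2 * n)`!%:R *
    \sum_(1 <= r < n.+1) (-1) ^+ r *
      \sum_(i in compositions n r)
        (2 * N)`!%:R ^+ r / \prod_(j < r) (2 * N + 2 * i j)`!%:R.
Proof.
pose c i : rat := (2 * N)`!%:R / (2 * N + 2 * i)`!%:R.
have nz k : k`!%:R != 0 :> rat by rewrite pnatr_eq0 -lt0n fact_gt0.
(* The factor [(0 < i)] removes [c 0 = 1], which becomes the [1] of [1 + q]. *)
pose q : {poly rat} := \poly_(i < n.+1) (c i *+ (0 < i)%N).
have q0 : q`_0 = 0 by rewrite coef_poly.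
pose g : {poly rat} := \sum_(r < n.+1) (- q) ^+ r.
have inv_g : (1 + q) * g = 1 - (- q) ^+ n.+1.
  by rewrite -[RHS]opprB subrX1 -mulNr opprB opprK.
have F0 : euler_F N 0 != 0 by rewrite euler_FE addn0 divff ?oner_eq0.
have F_q k : (k <= 2 * n)%N -> euler_F N k = ((1 + q) \Po 'X^2)`_k.
  move=> lek; rewrite euler_FE coef_comp_poly_Xn // dvdn2.
  case: ifPn => //= even_k; have def_k : k = (2 * (k %/ 2))%N.
    by rewrite mulnC divnK // dvdn2.
  have lekn : (k %/ 2 < n.+1)%N by rewrite ltnS -(leq_pmul2l (m := 2)) -?def_k.
  rewrite [in LHS]def_k coefD coef1 coef_poly lekn /c.
  by case: (k %/ 2)%N => [|m]; rewrite ?muln0 ?addn0 ?divff ?addr0 ?add0r.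
have -> : hypergeometric_euler N (2 * n) = (2 * n)`!%:R * g`_n.
  rewrite /hypergeometric_euler; congr (_ * _).
  rewrite -(@fps_inv_unique_upto _ (fun k => (g \Po 'X^2)`_k)) //.
    by rewrite coef_comp_poly_Xn // dvdn_mulr // mulKn.
  move=> k lek; transitivity (((1 + q) \Po 'X^2) * (g \Po 'X^2))`_k.
    rewrite coefM; apply: eq_bigr => i _; rewrite F_q //.
    by rewrite (leq_trans _ lek) // -ltnS.
  (* The error [(- q) ^+ n.+1] starts at degree [n.+1] in [s], beyond [k %/ 2 <= n]. *)
  rewrite -comp_polyM inv_g coef_comp_poly_Xn // coefB coef1 coef_exp_lt.
  - rewrite subr0 /fps1; case: ifPn => [/divnK {2}<-|].
      by rewrite muln_eq0 orbF.
    by case: k {lek}.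
  - by rewrite coefN q0 oppr0.
  - by rewrite ltnS -[n](@mulKn n 2) // leq_div2r.
congr (_ * _); rewrite coef_sum -(big_mkord xpredT (fun r => ((- q) ^+ r)`_n)).
(* The term [r = 0] is the constant [1], with no coefficient at [n >= 1]. *)
rewrite big_ltn // expr0 coef1 eqn0Ngt hn add0r; apply: eq_bigr => r _.
have sgnP : ((-1) ^+ r)%:P = (-1) ^+ r :> {poly rat}.
  by rewrite rmorphXn rmorphN1.
rewrite (exprNn q) -sgnP coefCM coef_exp_compositions ?size_poly //.
congr (_ * _); apply: eq_bigr => i; rewrite inE => /andP[/forallP i_gt0 _].
under eq_bigr => j _ do rewrite coef_poly ltn_ord i_gt0 mulr1n.
by rewrite prodf_div prodr_const card_ord.
Qed.
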